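(* Let $\Bbbk$ be an algebraically closed field with $\mathrm{char}(\Bbbk)\neq2$, let $G=\mathbb{Z}_2=\{\bar0,\bar1\}$ with character group $\hat G=\{\chi_0,\chi_1\}$, $\chi_0(\bar1)=1$, $\chi_1(\bar1)=-1$, and let $A$ be a finite dimensional unital associative $\mathbb{Z}_2$-graded $\Bbbk$-algebra. Identify each $\mathcal{Z}^G(A)_{g,\chi}$ with a subspace of $A$ via $\mathbf{x}\mapsto x^{(0)}$. Then the $G\times\hat G$-grading of $\mathcal{Z}^G(A)$ satisfies: (i) $s\mathcal{Z}(A)=\mathcal{Z}^G(A)_{\bar0,\chi_0}\oplus\mathcal{Z}^G(A)_{\bar1,\chi_1}$; (ii) $a\mathcal{Z}(A)=\mathcal{Z}^G(A)_{\bar0,\chi_1}\oplus\mathcal{Z}^G(A)_{\bar1,\chi_0}$. Hence, as vector spaces, $\mathcal{Z}^G(A)=s\mathcal{Z}(A)\oplus a\mathcal{Z}(A)$, where the latter direct sum is abstract (external), not inside $A$.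
   Context: The super centre $s\mathcal{Z}(A)$ is the subalgebra of $A$ spanned by homogeneous $x$ with $xy=(-1)^{\partial x\,\partial y}yx$ for all homogeneous $y\in A$. The anti centre $a\mathcal{Z}(A)$ is the subspace of $A$ spanned by homogeneous $x$ with $xy=(-1)^{(\partial x+1)\partial y}yx$ for all homogeneous $y\in A$. Here $\partial$ denotes degree. For $G=\mathbb{Z}_2$, $A\otimes\Bbbk^G=\mathrm{Hom}_{\mathbf{Set}}(G,A)$ with pointwise multiplication, elements $\mathbf{x}:g\mapsto x^{(g)}$, $G$-grading $(A\otimes\Bbbk^G)_g=A_g\otimes\Bbbk^G$. The $G$-centre is the $G$-graded subalgebra $$\mathcal{Z}^G(A)=\{\mathbf{x}\in A\otimes\Bbbk^G\mid x^{(g)}y=yx^{(g+h)}\text{ for all }g,h\in G,\ y\in A_h\},$$ which is also $\hat G$-graded by $\mathcal{Z}^G(A)_\chi=\{\mathbf{x}\in\mathcal{Z}^G(A)\mid x^{(g)}=\chi(g)x^{(0)}\ \forall g\in G\}$; $\mathcal{Z}^G(A)_{g,\chi}=\mathcal{Z}^G(A)_g\cap\mathcal{Z}^G(A)_\chi$. *)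

(* Defs.v *)
From HB Require Import structures.
From mathcomp Require Import all_boot all_order all_algebra all_field.
From mathcomp Require Import boolp.

Set Implicit Arguments.
Unset Strict Implicit.
Unset Printing Implicit Defensive.

Import GRing.Theory.
Local Open Scope ring_scope.

Lemma vspan_seq (K : fieldType) (V : vectType K) (P : V -> Prop) :
  exists s : seq V,
    (forall x, x \in s -> P x) /\ (forall x, P x -> x \in <<s>>%VS).
Proof.
pose Q n := `[< exists s : seq V,
  (forall x, x \in s -> P x) /\ \dim <<s>>%VS = n >].
have exQ : exists n, Q n.
  by exists (\dim <<[::] : seq V>>%VS); apply/asboolP; exists [::].
have Qle n : Q n -> (n <= \dim {:V})%N.
  by move=> /asboolP[s [_ <-]]; apply/dimvS/subvf.
case: (ex_maxnP exQ Qle) => n /asboolP[s [Ps ds]] maxn.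
exists s; split=> // x Px.
have sub : (<<s>> <= <<x :: s>>)%VS.
  by apply: sub_span => y ys; rewrite inE ys orbT.
have le : (\dim <<x :: s>>%VS <= \dim <<s>>%VS)%N.
  rewrite ds; apply: maxn; apply/asboolP; exists (x :: s); split=> // y.
  by rewrite inE => /predU1P[->|/Ps].
have /eqP-> : (<<s>> == <<x :: s>>)%VS by rewrite eqEdim sub le.
by apply: memv_span; rewrite inE eqxx.
Qed.

(* The linear span of an arbitrary, possibly infinite, set of vectors;
   characterised by mem_vspan. *)
Definition vspan (K : fieldType) (V : vectType K) (P : V -> Prop) :
  {vspace V} := (<<sval (cid (vspan_seq P))>>)%VS.

Lemma mem_vspan (K : fieldType) (V : vectType K) (P : V -> Prop) x :
  x \in vspan P <->
  exists s : seq V, (forall y, y \in s -> P y) /\ x \in <<s>>%VS.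
Proof.
rewrite /vspan; case: cid => s /= [Ps sP].
split=> [xs|[t [Pt xt]]]; first by exists s.
by apply: subvP xt; apply/span_subvP => y /Pt/sP.
Qed.

Lemma sub_vspan (K : fieldType) (V : vectType K) (P : V -> Prop) x :
  P x -> x \in vspan P.
Proof. by rewrite /vspan; case: cid => s /= [_]; apply. Qed.

Lemma vspan_sub (K : fieldType) (V : vectType K) (P : V -> Prop)
    (W : {vspace V}) :
  (forall x, P x -> x \in W) -> (vspan P <= W)%VS.
Proof.
by rewrite /vspan; case: cid => s /= [Ps _] PW; apply/span_subvP => x /Ps/PW.
Qed.

Lemma vspan_id (K : fieldType) (V : vectType K) (P : V -> Prop) :
  P 0 -> (forall a x y, P x -> P y -> P (a *: x + y)) ->
  forall x, x \in vspan P <-> P x.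
Proof.
move=> P0 Plin x; split=> [|/sub_vspan//].
move=> /mem_vspan[s [Ps xs]].
rewrite (@coord_span _ _ _ (in_tuple s) x xs).
elim/big_ind: _ => // [y z Py Pz|i _]; first by rewrite -[y]scale1r; exact: Plin.
by rewrite -[_ *: _]addr0; apply: Plin => //; apply/Ps/mem_nth.
Qed.

(* Here 'Z_2 is the group {0, 1} of degrees, and A_ g the homogeneous
   component of degree g. *)
Definition is_grading (K : fieldType) (A : falgType K)
    (A_ : 'Z_2 -> {vspace A}) : Prop :=
  [/\ (\sum_g A_ g)%VS = fullv, directv (\sum_g A_ g)
    & forall g h x y, x \in A_ g -> y \in A_ h -> x * y \in A_ (g + h)].

Definition super_centre (K : fieldType) (A : falgType K)
    (A_ : 'Z_2 -> {vspace A}) : {vspace A} :=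
  vspan (fun x => exists2 g : 'Z_2, x \in A_ g &
    forall (h : 'Z_2) y, y \in A_ h ->
      x * y = (-1) ^+ (g * h)%N *: (y * x)).

Definition anti_centre (K : fieldType) (A : falgType K)
    (A_ : 'Z_2 -> {vspace A}) : {vspace A} :=
  vspan (fun x => exists2 g : 'Z_2, x \in A_ g &
    forall (h : 'Z_2) y, y \in A_ h ->
      x * y = (-1) ^+ ((g + 1) * h)%N *: (y * x)).

(* The set defining each of the next three spaces is already a subspace, so
   that taking the span adds nothing: see the mem_ lemmas. *)
Definition G_centre (K : fieldType) (A : falgType K)
    (A_ : 'Z_2 -> {vspace A}) : {vspace {ffun 'Z_2 -> A}} :=
  vspan (fun x : {ffun 'Z_2 -> A} =>
    forall (g h : 'Z_2) y, y \in A_ h -> x g * y = y * x (g + h)).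

Definition G_centre_deg (K : fieldType) (A : falgType K)
    (A_ : 'Z_2 -> {vspace A}) (g : 'Z_2) : {vspace {ffun 'Z_2 -> A}} :=
  vspan (fun x : {ffun 'Z_2 -> A} =>
    x \in G_centre A_ /\ forall h : 'Z_2, x h \in A_ g).

Definition G_centre_char (K : fieldType) (A : falgType K)
    (A_ : 'Z_2 -> {vspace A}) (chi : 'Z_2 -> K) :
    {vspace {ffun 'Z_2 -> A}} :=
  vspan (fun x : {ffun 'Z_2 -> A} =>
    x \in G_centre A_ /\ forall g : 'Z_2, x g = chi g *: x 0).

Definition G_centre_bideg (K : fieldType) (A : falgType K)
    (A_ : 'Z_2 -> {vspace A}) (g : 'Z_2) (chi : 'Z_2 -> K) :
    {vspace {ffun 'Z_2 -> A}} :=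
  (G_centre_deg A_ g :&: G_centre_char A_ chi)%VS.

Lemma mem_G_centre (K : fieldType) (A : falgType K)
    (A_ : 'Z_2 -> {vspace A}) (x : {ffun 'Z_2 -> A}) :
  x \in G_centre A_ <->
  (forall (g h : 'Z_2) y, y \in A_ h -> x g * y = y * x (g + h)).
Proof.
apply: vspan_id => [g h y _|a u v Pu Pv g h y yh].
  by rewrite !ffunE mul0r mulr0.
by rewrite !ffunE mulrDl mulrDr -scalerAl -scalerAr (Pu g h) ?(Pv g h).
Qed.

Lemma mem_G_centre_deg (K : fieldType) (A : falgType K)
    (A_ : 'Z_2 -> {vspace A}) g (x : {ffun 'Z_2 -> A}) :
  x \in G_centre_deg A_ g <->
  x \in G_centre A_ /\ (forall h : 'Z_2, x h \in A_ g).
Proof.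
apply: vspan_id => [|a u v [Zu Pu] [Zv Pv]]; split=> [|h].
- exact: mem0v.
- by rewrite ffunE mem0v.
- by rewrite memvD ?memvZ.
- by rewrite !ffunE memvD ?memvZ.
Qed.

Lemma mem_G_centre_char (K : fieldType) (A : falgType K)
    (A_ : 'Z_2 -> {vspace A}) chi (x : {ffun 'Z_2 -> A}) :
  x \in G_centre_char A_ chi <->
  x \in G_centre A_ /\ (forall g : 'Z_2, x g = chi g *: x 0).
Proof.
apply: vspan_id => [|a u v [Zu Pu] [Zv Pv]]; split=> [|h].
- exact: mem0v.
- by rewrite !ffunE scaler0.
- by rewrite memvD ?memvZ.
- by rewrite !ffunE Pu Pv scalerDr !scalerA mulrC.
Qed.

Definition chi0 (K : fieldType) (g : 'Z_2) : K := 1.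
Definition chi1 (K : fieldType) (g : 'Z_2) : K := (-1) ^+ g.
Arguments chi0 {K} g.
Arguments chi1 {K} g.

Lemma Z2_characters (K : fieldType) (chi : 'Z_2 -> K) :
  (chi 0 = 1 /\ forall g h, chi (g + h) = chi g * chi h) <->
  chi = chi0 \/ chi = chi1.
Proof.
have Z2 (g : 'Z_2) : g = 0 \/ g = 1.
  by case: g => [[|[|//]] lt]; [left|right]; apply: val_inj.
have two0 : (1 + 1 : 'Z_2) = 0 by apply: val_inj.
split=> [[c0 cM]|[]->].
- have /eqP : chi 1 ^+ 2 = 1 by rewrite expr2 -cM two0.
  rewrite sqrf_eq1 => /orP[]/eqP c1; [left|right]; apply/funext => g;
    by case: (Z2 g) => ->.
- by split=> // g h; rewrite /chi0 mulr1.
- split=> // g h; rewrite /chi1.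
  case: (Z2 g) => ->; first by rewrite add0r mul1r.
  case: (Z2 h) => ->; first by rewrite addr0 mulr1.
  by rewrite two0 /= !expr1 mulrNN mulr1.
Qed.

Definition ev0 (K : fieldType) (A : falgType K) :
  'Hom({ffun 'Z_2 -> A}, A) := linfun (fun x : {ffun 'Z_2 -> A} => x 0).

Lemma ev0E (K : fieldType) (A : falgType K) (x : {ffun 'Z_2 -> A}) :
  ev0 A x = x 0.
Proof.
have lin : linear (fun x : {ffun 'Z_2 -> A} => x 0).
  by move=> a u v; rewrite !ffunE.
pose f : {linear {ffun 'Z_2 -> A} -> A} := HB.pack
  (fun x : {ffun 'Z_2 -> A} => x 0) (GRing.isLinear.Build _ _ _ _ _ lin).
exact: (lfunE f).
Qed.

(* The image of G_centre_bideg A_ g chi in A under x |-> x 0. *)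
Definition G_centre_in (K : fieldType) (A : falgType K)
    (A_ : 'Z_2 -> {vspace A}) (g : 'Z_2) (chi : 'Z_2 -> K) : {vspace A} :=
  (ev0 A @: G_centre_bideg A_ g chi)%VS.
Arguments G_centre_in {K A} A_ g%_R chi.

Lemma ev0_inj (K : fieldType) (A : falgType K)
    (A_ : 'Z_2 -> {vspace A}) (g : 'Z_2) (chi : 'Z_2 -> K) :
  {in G_centre_bideg A_ g chi &, injective (ev0 A)}.
Proof.
move=> x y /memv_capP[_ /mem_G_centre_char[_ xc]].
move=> /memv_capP[_ /mem_G_centre_char[_ yc]].
by rewrite !ev0E => xy; apply/ffunP => h; rewrite xc yc xy.
Qed.

(* Main.v *)
(* The parity automorphism sigma acts on A_g as (-1)^g, and an element
   x = (x^(0), x^(1)) of the G-centre lies in bidegree (g, chi) exactly when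
   x^(0) is homogeneous of degree g and commutes with y up to the sign
   chi (deg y); the two sign patterns of the definitions of the super and anti
   centre are the two pairs of bidegrees.  Hence the maps
   x |-> (x^(0) + sigma x^(1)) / 2 and x |-> (x^(0) - sigma x^(1)) / 2 split the
   G-centre into the two centres, with inverse
   (s, a) |-> (s + a, sigma (s - a)). *)
Require Import Defs.
From HB Require Import structures.
From mathcomp Require Import all_boot all_order all_algebra all_field.
From mathcomp Require Import boolp.

Import GRing.Theory.
Local Open Scope ring_scope.

Lemma Z2_cases (g : 'Z_2) : g = 0 \/ g = 1.
Proof. by case: g => [[|[|//]] lt]; [left|right]; apply: val_inj. Qed.

Lemma Z2_addrr (g : 'Z_2) : g + g = 0.
Proof. by case: (Z2_cases g) => ->; apply: val_inj. Qed.

(** * The parity operator of a graded algebra *)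

Section Parity.
Context {K : fieldType} {A : falgType K} {A_ : 'Z_2 -> {vspace A}}.
Hypothesis grA : is_grading A_.

Lemma grading_split x :
  exists u v, [/\ u \in A_ 0, v \in A_ 1 & x = u + v].
Proof.
have [sumA _ _] := grA; have := memvf x; rewrite -sumA => /memv_sumP[u Au ->].
exists (u 0), (u 1); split; [exact: Au|exact: Au|].
by rewrite big_ord_recl big_ord1; congr (_ + u _); apply: val_inj.
Qed.

Lemma homogeneous_eq0 x : x \in A_ 0 -> x \in A_ 1 -> x = 0.
Proof.
move=> x0 x1; have [_ /directv_sumP/(_ 0 isT) cap0 _] := grA.
apply/eqP; rewrite -memv0 -cap0 memv_cap x0.
by apply: subvP x1; apply: (sumv_sup 1).
Qed.

Lemma directv_homogeneous (U V : {vspace A}) :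
  (U <= A_ 0%R)%VS -> (V <= A_ 1%R)%VS -> directv (U + V).
Proof.
move=> /subvP UA /subvP VA; apply/directv_addP/eqP.
rewrite -subv0; apply/subvP => x; rewrite memv_cap memv0 => /andP[/UA x0 /VA x1].
by rewrite (homogeneous_eq0 x).
Qed.

(** The difference of the projections onto [A_ 0] and [A_ 1] has this property. *)
Lemma exists_parity :
  exists sigma : 'End(A), forall g x, x \in A_ g -> sigma x = (-1) ^+ g *: x.
Proof.
have [sumA _ _] := grA.
pose pr g := sumv_pi_for (esym sumA) g.
have prA g x : pr g x \in A_ g by exact: memv_sum_pi.
have prE x : x = pr 0 x + pr 1 x.
  rewrite -[LHS](sumv_pi_sum (esym sumA) (memvf x)) big_ord_recl big_ord1.
  by congr (_ + pr _ _); apply: val_inj.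
exists (pr 0 - pr 1) => g x.
rewrite add_lfunE opp_lfunE.
case: (Z2_cases g) => -> xg.
  (* This component is [x] minus a vector of [A_ 0], so it lies in both [A_ 0] and [A_ 1]. *)
  have /eqP : pr 1 x = 0.
    apply: homogeneous_eq0 => //.
    by rewrite -(addKr (pr 0 x) (pr 1 x)) -prE memvD ?memvN.
  by move=> /eqP p1; rewrite [in RHS](prE x) p1 !(subr0, addr0) scale1r.
have p0 : pr 0 x = 0.
  apply: homogeneous_eq0 => //.
  by rewrite -(addrK (pr 1 x) (pr 0 x)) -prE memvB.
by rewrite [in RHS](prE x) p0 !add0r scaleN1r.
Qed.

End Parity.

(** Puts both centres in one family: [b = 0] is the super centre, [b = 1] the anti centre. *)
Definition signed_centre {K : fieldType} {A : falgType K}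
    (A_ : 'Z_2 -> {vspace A}) (b : nat) : {vspace A} :=
  vspan (fun x => exists2 g : 'Z_2, x \in A_ g &
    forall (h : 'Z_2) y, y \in A_ h ->
      x * y = (-1) ^+ ((g + b) * h)%N *: (y * x)).

(** * The two centres as sums of bihomogeneous components of the G-centre *)

Section Centres.
Context {K : fieldType} {A : falgType K} {A_ : 'Z_2 -> {vspace A}}.

Lemma super_centreE : super_centre A_ = signed_centre A_ 0.
Proof.
by apply/eqP; rewrite eqEsubv; apply/andP; split;
  apply: vspan_sub => x [g xg xc]; apply: sub_vspan;
  exists g => // h y yh; rewrite (xc h) ?addn0.
Qed.

Lemma anti_centreE : anti_centre A_ = signed_centre A_ 1.
Proof. by []. Qed.

Lemma mem_G_centre_bideg (g : 'Z_2) chi (x : {ffun 'Z_2 -> A}) :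
  x \in G_centre_bideg A_ g chi <->
  [/\ x \in G_centre A_, forall h, x h \in A_ g
    & forall h, x h = chi h *: x 0].
Proof.
rewrite memv_cap; split=> [/andP[]|[xZ xg xc]].
  by move=> /mem_G_centre_deg[xZ xg] /mem_G_centre_char[_ xc].
by apply/andP; split; [apply/mem_G_centre_deg|apply/mem_G_centre_char].
Qed.

(** A family with character [chi] is [h |-> chi h *: x]. The G-centre relation at index 0 is then
    the commutation rule, and multiplicativity of [chi] carries it to the other index. *)
Lemma mem_G_centre_in (g : 'Z_2) chi x :
  chi 0 = 1 -> (forall h k, chi (h + k) = chi h * chi k) ->
  x \in G_centre_in A_ g chi <->
  x \in A_ g /\ (forall h y, y \in A_ h -> x * y = chi h *: (y * x)).
Proof.
move=> chi_0 chiM; split=> [/memv_imgP[z /mem_G_centre_bideg]|[xg xc]].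
  rewrite ev0E => -[/mem_G_centre zZ zg zc] ->; split=> // h y yh.
  by rewrite (zZ 0 h) // add0r zc scalerAr.
apply/memv_imgP; exists [ffun h => chi h *: x]; last first.
  by rewrite ev0E ffunE chi_0 scale1r.
apply/mem_G_centre_bideg; split=> [|h|h].
- apply/mem_G_centre => h k y yk; rewrite !ffunE -scalerAl -scalerAr (xc k) //.
  by rewrite scalerA chiM.
- by rewrite ffunE memvZ.
- by rewrite !ffunE chi_0 scale1r.
Qed.

(** Characters written with the exponents that define the centres: even [n] gives [chi0], odd [n]
    gives [chi1]. *)
Definition sgn_char (n : nat) (h : 'Z_2) : K := (-1) ^+ (n * h)%N.

Lemma sgn_char0 n : sgn_char n 0 = 1.
Proof. by rewrite /sgn_char muln0. Qed.

Lemma sgn_charD n h k : sgn_char n (h + k) = sgn_char n h * sgn_char n k.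
Proof.
case: (Z2_cases h) => ->; first by rewrite add0r sgn_char0 mul1r.
case: (Z2_cases k) => ->; first by rewrite addr0 sgn_char0 mulr1.
by rewrite Z2_addrr sgn_char0 /sgn_char muln1 -expr2 sqrr_sign.
Qed.

Lemma sgn_char_even n : sgn_char n.*2 = chi0.
Proof.
apply/funext => h; rewrite /sgn_char -muln2 -mulnA mulnC -mulnA exprM.
by rewrite sqrrN !expr1n.
Qed.

Lemma sgn_char1 : sgn_char 1 = chi1.
Proof. by apply/funext => h; rewrite /sgn_char mul1n. Qed.

Lemma mem_G_centre_in_sgn (g : 'Z_2) n x :
  x \in G_centre_in A_ g (sgn_char n) <->
  x \in A_ g /\ (forall h y, y \in A_ h ->
    x * y = (-1) ^+ (n * h)%N *: (y * x)).
Proof. by apply: mem_G_centre_in; [exact: sgn_char0|exact: sgn_charD]. Qed.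

Lemma G_centre_in_sub (g : 'Z_2) n :
  (G_centre_in A_ g (sgn_char n) <= A_ g)%VS.
Proof. by apply/subvP => x /mem_G_centre_in_sgn[]. Qed.

(** A generator of degree [g] obeys the sign rule of [sgn_char (g + b)], so sorting the generators
    by degree gives the two summands. *)
Lemma signed_centreE b :
  signed_centre A_ b =
  (G_centre_in A_ 0 (sgn_char b) + G_centre_in A_ 1 (sgn_char b.+1))%VS.
Proof.
apply/eqP; rewrite eqEsubv subv_add; apply/and3P; split.
- apply: vspan_sub => x [g]; case: (Z2_cases g) => -> xg xc.
    by apply: (subvP (addvSl _ _)); apply/mem_G_centre_in_sgn.
  by apply: (subvP (addvSr _ _)); apply/mem_G_centre_in_sgn.
- apply/subvP => x /mem_G_centre_in_sgn[xg xc]; apply: sub_vspan.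
  by exists 0.
- apply/subvP => x /mem_G_centre_in_sgn[xg xc]; apply: sub_vspan.
  by exists 1.
Qed.

End Centres.

(** * Splitting the G-centre by means of parity *)

Section Splitting.
Context {K : fieldType} {A : falgType K} {A_ : 'Z_2 -> {vspace A}}.
Hypothesis grA : is_grading A_.
Variable sigma : 'End(A).
Hypothesis sigmaE : forall g x, x \in A_ g -> sigma x = (-1) ^+ g *: x.

Lemma parityK x : sigma (sigma x) = x.
Proof.
have [u [v [u0 v1 ->]]] := grading_split grA x.
rewrite linearD /= (sigmaE _ _ u0) (sigmaE _ _ v1) linearD !linearZ /=.
by rewrite (sigmaE _ _ u0) (sigmaE _ _ v1) !scalerA -!expr2 !sqrr_sign !scale1r.
Qed.

(** Split [x] by degree: each product with [y] is homogeneous, and its sign is the product of the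
    signs of its factors. *)
Lemma parity_mulr h x y :
  y \in A_ h -> sigma (x * y) = (-1) ^+ h *: (sigma x * y).
Proof.
move=> yh; have [_ _ mulA] := grA; have [u [v [u0 v1 ->]]] := grading_split grA x.
rewrite mulrDl !linearD /= (sigmaE _ _ (mulA _ _ _ _ u0 yh)) add0r.
rewrite (sigmaE _ _ (mulA _ _ _ _ v1 yh)) (sigmaE _ _ u0) (sigmaE _ _ v1) scale1r.
rewrite mulrDl scalerDr; congr (_ + _); rewrite -scalerAl scalerA.
(* The degree [1 + h] is reduced modulo 2, so its sign is split by [sgn_charD] rather than by
   [exprD]. *)
by have := @sgn_charD K 1 1 h; rewrite /sgn_char !mul1n mulrC => ->.
Qed.

Lemma parity_mull h x y :
  y \in A_ h -> sigma (y * x) = (-1) ^+ h *: (y * sigma x).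
Proof.
move=> yh; have [_ _ mulA] := grA; have [u [v [u0 v1 ->]]] := grading_split grA x.
rewrite mulrDr !linearD /= (sigmaE _ _ (mulA _ _ _ _ yh u0)) addr0.
rewrite (sigmaE _ _ (mulA _ _ _ _ yh v1)) (sigmaE _ _ u0) (sigmaE _ _ v1) scale1r.
rewrite mulrDr scalerDr; congr (_ + _); rewrite -scalerAr scalerA.
by have := @sgn_charD K 1 h 1; rewrite /sgn_char !mul1n => ->.
Qed.

(** The two summands of the inverse map: [s |-> (s, sigma s)] for [b = 0] and [a |-> (a, - sigma a)]
    for [b = 1]. *)
Definition unsplit_fun (b : nat) (s : A) : {ffun 'Z_2 -> A} :=
  [ffun h => if h == 0 then s else (-1) ^+ b *: sigma s].

Lemma unsplit_fun_linear b : linear (unsplit_fun b).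
Proof.
move=> a u v; apply/ffunP => h; rewrite !ffunE.
by case: eqP => // _; rewrite linearP scalerDr !scalerA mulrC.
Qed.

Lemma unsplit_fun_homogeneous b g s h : s \in A_ g ->
  unsplit_fun b s h = sgn_char (g + b) h *: s.
Proof.
move=> sg; rewrite ffunE; case: (Z2_cases h) => ->.
  by rewrite sgn_char0 scale1r.
by rewrite (sigmaE _ _ sg) scalerA /sgn_char muln1 exprD mulrC.
Qed.

Lemma unsplit_in_G_centre b s :
  s \in signed_centre A_ b -> unsplit_fun b s \in G_centre A_.
Proof.
pose f : {linear A -> {ffun 'Z_2 -> A}} := HB.pack (unsplit_fun b)
  (GRing.isLinear.Build _ _ _ _ _ (unsplit_fun_linear b)).
(* The preimage of the G-centre under a linear map is a subspace, so it suffices to test homogeneous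
   generators. *)
rewrite -[unsplit_fun b s]/(f s) -lfunE memv_preim.
apply/subvP: s; apply: vspan_sub => s [g sg sc].
rewrite -memv_preim lfunE /=; apply/mem_G_centre => h k y yk.
rewrite !(unsplit_fun_homogeneous _ _ _ _ sg) -scalerAl -scalerAr (sc k) //.
by rewrite scalerA sgn_charD.
Qed.

Definition split_fun (b : nat) (x : {ffun 'Z_2 -> A}) : A :=
  2%:R^-1 *: (x 0 + (-1) ^+ b *: sigma (x 1)).

Lemma split_fun_linear b : linear (split_fun b).
Proof.
move=> a u v; rewrite /split_fun !ffunE linearP /= !scalerDr !scalerA.
by rewrite ![a * _]mulrC -!mulrA ![_ * a]mulrC !mulrA addrACA -!mulrA.
Qed.

Hypothesis two_neq0 : 2%:R != 0 :> K.

Lemma half_double (x : A) : 2%:R^-1 *: (x + x) = x.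
Proof. by rewrite -mulr2n -scaler_nat scalerA mulVf // scale1r. Qed.

Lemma even_part x : 2%:R^-1 *: (x + sigma x) \in A_ 0.
Proof.
have [u [v [u0 v1 ->]]] := grading_split grA x.
rewrite [sigma _]linearD /= (sigmaE _ _ u0) (sigmaE _ _ v1) scale1r scaleN1r.
by rewrite addrACA subrr addr0 half_double.
Qed.

Lemma odd_part x : 2%:R^-1 *: (x - sigma x) \in A_ 1.
Proof.
have [u [v [u0 v1 ->]]] := grading_split grA x.
rewrite [sigma _]linearD /= (sigmaE _ _ u0) (sigmaE _ _ v1) scale1r scaleN1r.
by rewrite opprD opprK addrACA subrr add0r half_double.
Qed.

(** Applying [sigma] to the defining relation puts the same sign on both sides, and it cancels. This
    is what keeps the even and odd parts of [x] in the G-centre. *)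
Lemma parity_G_centre (x : {ffun 'Z_2 -> A}) :
  x \in G_centre A_ -> [ffun g => sigma (x g)] \in G_centre A_.
Proof.
move=> /mem_G_centre xZ; apply/mem_G_centre => g h y yh; rewrite !ffunE.
have := congr1 sigma (xZ g h y yh); rewrite (parity_mulr _ _ _ yh).
by rewrite (parity_mull _ _ _ yh) => /scalerI; apply; rewrite signr_eq0.
Qed.

(** An even [y] commutes with both entries of [x], and an odd [y] swaps them as it passes. With
    [e = (-1) ^+ (g + b)], the swap turns [x 0 + e x 1] into [x 1 + e x 0 = e (x 0 + e x 1)], since
    [e ^+ 2 = 1]. *)
Lemma split_homogeneous b g (x : {ffun 'Z_2 -> A}) :
  x \in G_centre A_ -> (forall h, x h \in A_ g) ->
  split_fun b x \in signed_centre A_ b.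
Proof.
move=> /mem_G_centre xZ xg; apply: sub_vspan; exists g => [|h y yh].
  by rewrite memvZ // memvD // memvZ // (sigmaE _ _ (xg 1)) memvZ.
rewrite /split_fun (sigmaE _ _ (xg 1)) scalerA -exprD [(b + g)%N]addnC.
rewrite -scalerAl -scalerAr mulrDl mulrDr -scalerAl -scalerAr.
rewrite scalerA mulrC -scalerA; congr (_ *: _).
rewrite (xZ 0 h) // (xZ 1 h) // add0r.
case: (Z2_cases h) yh => -> yh; first by rewrite addr0 muln0 scale1r.
rewrite Z2_addrr muln1 scalerDr scalerA -expr2 sqrr_sign scale1r.
by rewrite addrC.
Qed.

Lemma split_G_centre b x :
  x \in G_centre A_ -> split_fun b x \in signed_centre A_ b.
Proof.
move=> xZ; have sxZ := parity_G_centre _ xZ.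
(* These are the even and odd parts of [x], to which the homogeneous case applies. *)
have -> : x = 2%:R^-1 *: (x + [ffun g => sigma (x g)])
            + 2%:R^-1 *: (x - [ffun g => sigma (x g)]).
  rewrite -scalerDr addrACA subrr addr0; apply/ffunP => g.
  by rewrite !ffunE half_double.
rewrite -[X in X + _]scale1r split_fun_linear scale1r.
apply: memvD.
  apply: (split_homogeneous _ 0) => [|h].
    by rewrite memvZ // memvD.
  by rewrite !ffunE even_part.
apply: (split_homogeneous _ 1) => [|h].
  by rewrite memvZ // memvB.
by rewrite !ffunE odd_part.
Qed.

(** At index 0 the [sigma (x 1)] terms cancel; at index 1 the [x 0] terms cancel and [sigma] undoes
    itself on [x 1]. *)
Lemma split_funK x :
  unsplit_fun 0 (split_fun 0 x) + unsplit_fun 1 (split_fun 1 x) = x.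
Proof.
apply/ffunP => h; rewrite !ffunE /split_fun.
case: (Z2_cases h) => -> /=; rewrite !(scale1r, scaleN1r).
  by rewrite -scalerDr addrACA subrr addr0 half_double.
rewrite -linearB -scalerBr opprD opprK addrACA subrr add0r half_double.
exact: parityK.
Qed.

Lemma unsplit_funK b s : split_fun b (unsplit_fun b s) = s.
Proof.
rewrite /split_fun !ffunE /= linearZ /= parityK scalerA -expr2 sqrr_sign.
by rewrite scale1r half_double.
Qed.

Lemma unsplit_fun_cross b c s :
  odd (b + c) -> split_fun b (unsplit_fun c s) = 0.
Proof.
move=> bc; rewrite /split_fun !ffunE /= linearZ /= parityK scalerA -exprD.
by rewrite -signr_odd bc scaleN1r subrr scaler0.
Qed.

(** Makes the splitting explicit on bihomogeneous elements: one coordinate becomes evaluation at 0,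
    and the other vanishes by [unsplit_fun_cross]. *)
Lemma bideg_unsplit (g : 'Z_2) b (x : {ffun 'Z_2 -> A}) :
  x \in G_centre_bideg A_ g (sgn_char (g + b)) -> x = unsplit_fun b (x 0).
Proof.
move=> /mem_G_centre_bideg[_ xg xc]; apply/ffunP => h.
rewrite (unsplit_fun_homogeneous _ _ _ _ (xg 0)); exact: xc.
Qed.

Lemma G_centre_splitting :
  exists phi : 'Hom(subvs_of (G_centre A_),
                    (subvs_of (signed_centre A_ 0) *
                     subvs_of (signed_centre A_ 1))%type),
    bijective phi /\
    forall x, vsval (phi x).1 = split_fun 0 (vsval x) /\
              vsval (phi x).2 = split_fun 1 (vsval x).
Proof.
(* [vsproj] is a linear projection; by [split_G_centre] both values already lie in the target
   subspaces, so it leaves them unchanged. *)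
pose f (x : subvs_of (G_centre A_)) :=
  (vsproj (signed_centre A_ 0) (split_fun 0 (vsval x)),
   vsproj (signed_centre A_ 1) (split_fun 1 (vsval x))).
have flin : linear f.
  by move=> a u v; rewrite /f linearP /= !split_fun_linear !linearP.
pose fl : {linear subvs_of (G_centre A_) -> _} := HB.pack f
  (GRing.isLinear.Build _ _ _ _ _ flin).
have fE x : linfun fl x = f x by rewrite lfunE.
exists (linfun fl); split=> [|x]; last first.
  by rewrite fE /= !vsprojK // split_G_centre // subvsP.
pose f' (sa : subvs_of (signed_centre A_ 0) * subvs_of (signed_centre A_ 1)) :=
  vsproj (G_centre A_)
    (unsplit_fun 0 (vsval sa.1) + unsplit_fun 1 (vsval sa.2)).
exists f' => [x|[s a]]; rewrite fE.
  apply/val_inj; rewrite /f' /= !vsprojK ?split_G_centre ?subvsP //.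
    by rewrite split_funK.
  by rewrite split_funK subvsP.
rewrite /f /f' vsprojK ?memvD ?unsplit_in_G_centre ?subvsP //.
rewrite -[unsplit_fun 0 _]scale1r !split_fun_linear !scale1r !unsplit_funK.
by rewrite !unsplit_fun_cross // addr0 add0r !vsvalK.
Qed.

End Splitting.

(** * The two decompositions and the external direct sum *)

Theorem proposition42 (K : closedFieldType) (charK : 2%N \notin [pchar K])
    (A : falgType K) (A_ : 'Z_2 -> {vspace A}) (grA : is_grading A_) :
  [/\ super_centre A_ = (G_centre_in A_ 0 chi0 + G_centre_in A_ 1 chi1)%VS
        /\ directv (G_centre_in A_ 0 chi0 + G_centre_in A_ 1 chi1),
      anti_centre A_ = (G_centre_in A_ 0 chi1 + G_centre_in A_ 1 chi0)%VS
        /\ directv (G_centre_in A_ 0 chi1 + G_centre_in A_ 1 chi0)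
    & exists phi : 'Hom(subvs_of (G_centre A_),
                        (subvs_of (super_centre A_) *
                         subvs_of (anti_centre A_))%type),
        [/\ bijective phi,
            forall x : subvs_of (G_centre A_),
              (vsval x \in G_centre_bideg A_ 0 chi0) ||
              (vsval x \in G_centre_bideg A_ 1 chi1) ->
              vsval (phi x).1 = ev0 A (vsval x) /\ (phi x).2 = 0
          & forall x : subvs_of (G_centre A_),
              (vsval x \in G_centre_bideg A_ 0 chi1) ||
              (vsval x \in G_centre_bideg A_ 1 chi0) ->
              (phi x).1 = 0 /\ vsval (phi x).2 = ev0 A (vsval x)]].
Proof.
have two_neq0 : 2%:R != 0 :> K by move: charK; rewrite !inE.
have [sigma sigmaE] := exists_parity grA.
rewrite super_centreE anti_centreE.
rewrite -(@sgn_char_even K 0) -(@sgn_char1 K).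
split; last 1 first.
- have [phi [phi_bij phiE]] := G_centre_splitting grA sigma sigmaE two_neq0.
  exists phi; split=> // x.
    move=> xbi; have xE : vsval x = unsplit_fun sigma 0 (vsval x 0).
      by case/orP: xbi; [apply: (bideg_unsplit sigma sigmaE 0)
                        |apply: (bideg_unsplit sigma sigmaE 1)].
    have [p1 p2] := phiE x; rewrite p1 ev0E; split.
      by rewrite {1}xE (unsplit_funK grA _ sigmaE).
    by apply: val_inj; rewrite [LHS]p2 xE (unsplit_fun_cross grA _ sigmaE).
  (* In degree 1 the anti centre has exponent [1 + 1], so [chi0] is rewritten from [sgn_char 0] to
     [sgn_char 2]. *)
  rewrite [sgn_char _.*2]sgn_char_even -(@sgn_char_even K 1).
  move=> xbi; have xE : vsval x = unsplit_fun sigma 1 (vsval x 0).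
    by case/orP: xbi; [apply: (bideg_unsplit sigma sigmaE 0)
                      |apply: (bideg_unsplit sigma sigmaE 1)].
  have [p1 p2] := phiE x; rewrite p2 ev0E; split.
    by apply: val_inj; rewrite [LHS]p1 xE (unsplit_fun_cross grA _ sigmaE).
  by rewrite {1}xE (unsplit_funK grA _ sigmaE).
(* The summands lie in [A_ 0] and [A_ 1], so directness inside [A] comes from the grading. *)
- by rewrite signed_centreE; split=> //;
    apply: (directv_homogeneous grA); exact: G_centre_in_sub.
- rewrite [sgn_char _.*2]sgn_char_even -(@sgn_char_even K 1) signed_centreE.
  by split=> //; apply: (directv_homogeneous grA); exact: G_centre_in_sub.
Qed.
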